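(* Let $f(x)=a_1x+a_2x^2+a_3x^3+a_4x^4+a_5x^5+\cdots$ be a formal power series with coefficients in a field and $a_1\neq 0$, and for $n\ge 1$ write its $n$-fold composition as $f^{(n)}(x)=f_1^{(n)}x+f_2^{(n)}x^2+f_3^{(n)}x^3+\cdots$. Then for every integer $n\ge 1$: $$f_1^{(n)}=a_1^n,$$ $$f_2^{(n)}=a_1^{n-1}a_2\sum_{i=0}^{n-1}a_1^{i},$$ $$f_3^{(n)}=a_1^{n-1}a_3\sum_{i=0}^{n-1}a_1^{2i}+2a_1^{n-1}a_2^2\sum_{i=0}^{n-2}a_1^{2i}\sum_{i_1=0}^{n-i-2}a_1^{i_1},$$ $$\begin{aligned}f_4^{(n)}={}&a_1^{n-1}a_4\sum_{i=0}^{n-1}a_1^{3i}+a_1^{n-1}a_2a_3\left[3a_1\sum_{i=0}^{n-2}a_1^{3i}\sum_{i_1=0}^{n-i-2}a_1^{2i_1}+2\sum_{i=0}^{n-2}a_1^{3i}\sum_{i_1=0}^{n-i-2}a_1^{i_1}\right]\\&+a_2^3a_1^{n-2}\left[\sum_{i=0}^{n-2}a_1^{3i}\sum_{i_1=0}^{n-i-2}a_1^{i_1}+6a_1^2\sum_{i=0}^{n-3}a_1^{3i}\sum_{i_1=0}^{n-i-3}a_1^{2i_1}\sum_{i_2=0}^{n-i-i_1-3}a_1^{i_2}\right],\end{aligned}$$ $$\begin{aligned}f_5^{(n)}={}&a_1^{n-1}a_5\sum_{i=0}^{n-1}a_1^{4i}+a_1^{n-1}a_2a_4\left[2\sum_{i=0}^{n-2}a_1^{4i}\sum_{i_1=0}^{n-i-2}a_1^{i_1}+4a_1^2\sum_{i=0}^{n-2}a_1^{4i}\sum_{i_1=0}^{n-i-2}a_1^{3i_1}\right]\\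 &+a_1^{n-2}a_3\Bigg\{3a_1^2a_3\sum_{i=0}^{n-2}a_1^{4i}\sum_{i_1=0}^{n-i-2}a_1^{2i_1}+a_2^2\Bigg[2\sum_{i=0}^{n-2}a_1^{4i}\sum_{i_1=0}^{n-i-2}a_1^{i_1}\\ &\quad+4a_1^3\sum_{i=0}^{n-3}a_1^{4i}\left(3a_1\sum_{i_1=0}^{n-i-3}a_1^{3i_1}\sum_{i_2=0}^{n-i-i_1-3}a_1^{2i_2}+2\sum_{i_1=0}^{n-i-3}a_1^{3i_1}\sum_{i_2=0}^{n-i-i_1-3}a_1^{i_2}\right)\\ &\quad+6a_1^2\sum_{i=0}^{n-3}a_1^{4i}\sum_{i_1=0}^{n-i-3}a_1^{2i_1}\sum_{i_2=0}^{n-i-i_1-3}a_1^{i_2}+3a_1\sum_{i=0}^{n-2}a_1^{4i}\sum_{i_1=0}^{n-i-2}a_1^{2i_1}\Bigg]\Bigg\}\\ &+a_1^{n-2}a_2^4\Bigg[\sum_{i=0}^{n-3}a_1^{4i}\left(4a_1^2\sum_{i_1=0}^{n-i-3}a_1^{3i_1}\sum_{i_2=0}^{n-i-i_1-3}a_1^{i_2}+6a_1\sum_{i_1=0}^{n-i-3}a_1^{2i_1}\sum_{i_2=0}^{n-i-i_1-3}a_1^{i_2}\right)\\ &\quad+24a_1^4\sum_{i=0}^{n-4}a_1^{4i}\sum_{i_1=0}^{n-i-4}a_1^{3i_1}\sum_{i_2=0}^{n-i-i_1-4}a_1^{2i_2}\sum_{i_3=0}^{n-i-i_1-i_2-4}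a_1^{i_3}\Bigg].\end{aligned}$$
   Context: The $n$-fold composition is defined by $f^{(1)}(x)=f(x)$ and $f^{(n)}(x)=f^{(n-1)}(f(x))$ for $n\ge 2$; $f_k^{(n)}$ is the coefficient of $x^k$ in $f^{(n)}(x)$. Empty sums (upper limit less than lower limit) are $0$. *)

(* Defs.v *)
From mathcomp Require Import all_boot all_order all_algebra.
Set Implicit Arguments.
Unset Strict Implicit.
Unset Printing Implicit Defensive.
Import GRing.Theory.
Local Open Scope ring_scope.

(* A formal power series u is given by its coefficients: u k is the
   coefficient of x^k. *)
Definition fps (R : comNzRingType) := nat -> R.

Definition fps_one (R : comNzRingType) : fps R := fun k => (k == 0)%:R.

Definition fps_X (R : comNzRingType) : fps R := fun k => (k == 1)%:R.

Definition fps_mul (R : comNzRingType) (u v : fps R) : fps R :=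
  fun k => \sum_(i < k.+1) u i * v (k - i)%N.

Definition fps_exp (R : comNzRingType) (u : fps R) (j : nat) : fps R :=
  iter j (fps_mul u) (fps_one R).

(* u(v(x)) = sum_j u_j v(x)^j. This is the usual composition only when
   v 0 = 0: v^j then has order at least j, so that the terms with j > k do not
   contribute to the coefficient of x^k. *)
Definition fps_comp (R : comNzRingType) (u v : fps R) : fps R :=
  fun k => \sum_(j < k.+1) u j * fps_exp v j k.

(* f^(1) = f and f^(n) = f^(n-1) o f for n >= 2; the value at n = 0 is the
   identity series x. *)
Fixpoint fps_iter (R : comNzRingType) (f : fps R) (n : nat) : fps R :=
  match n with
  | 0 => fps_X R
  | m.+1 => if m is 0 then f else fps_comp (fps_iter f m) f
  end.

(* Main.v *)
Require Import Defs.
From mathcomp Require Import all_boot all_order all_algebra.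
From mathcomp Require Import ring zify.
Set Implicit Arguments.
Unset Strict Implicit.
Unset Printing Implicit Defensive.
Import GRing.Theory.
Local Open Scope ring_scope.

(** Write g for the (n-1)-fold composite. Comparing coefficients of x^k in
    g(f(x)) = sum_j g_j f(x)^j gives the triangular linear recursion
      f_k^(n) = g_1 [x^k]f + g_2 [x^k]f^2 + ... + g_k [x^k]f^k,
    whose last coefficient is [x^k]f^k = a1^k ([fps_comp_coefs] lists it for
    k <= 5). Solving it for f_k^(n) as a first order recursion in n produces a
    sum over i of a1^(k i) times the earlier coefficients, which are
    themselves such sums: hence the nested geometric sums of the theorem. Their
    ratios are a1^(k-1) rather than a1^k because the factor a1^(n-1), present in
    every coefficient, has been taken out.

    It is therefore enough to check that the claimed expressions satisfy the
    recursion. A nested sum with outer ratio r, taken at n + 1, equals the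
    inner sum plus r times the same nested sum at n ([nest1S], [nestS]): this
    is what removing the term i = 0 does. The offsets n - 1, n - 2, n - 3 in
    the bounds grow with the depth of nesting, so that the inner sum produced
    in this way is exactly the nested sum that occurs in a coefficient of
    lower index. After these substitutions the induction step of
    [fps_iter_coefs] is a polynomial identity in a1, ..., a5, a1^(n-2) and the
    nested sums. *)

(** * Nested geometric sums *)

(** The sum, over all indices with i_1 + ... + i_d < n - c, of the products of
    the weights. For geometric weights of ratios q_1, ..., q_d and c = d - 1 it
    is the complete homogeneous symmetric polynomial of degree n - d in
    q_1, ..., q_d, 1. The singleton list has its own case so that no factor 1
    follows the innermost weight. *)
Fixpoint nest (R : pzRingType) (ws : seq (nat -> R)) (c n : nat) : R :=
  match ws with
  | [::] => 1
  | [:: w] => \sum_(0 <= i < n - c) w i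
  | w :: ws' => \sum_(0 <= i < n - c) w i * nest ws' c (n - i)
  end.

(** A property of an abstract sequence, rather than the powers of r themselves,
    so that a1^i and a1^(2 i) are covered without rewriting the latter as
    (a1^2)^i under the sums. *)
Definition geometric (R : pzRingType) (r : R) (w : nat -> R) :=
  w 0%N = 1 /\ forall i, w i.+1 = r * w i.

Lemma geometric_exp (R : pzRingType) (a : R) : geometric a (fun i => a ^+ i).
Proof. by split=> [|i]; rewrite ?expr0 ?exprS. Qed.

Lemma geometric_expM (R : pzRingType) (a : R) e :
  geometric (a ^+ e) (fun i => a ^+ (e * i)).
Proof. by split=> [|i]; rewrite ?muln0 ?expr0 // mulnS exprD. Qed.

Lemma nest_eq0 (R : pzRingType) (w : nat -> R) ws c n :
  (n <= c)%N -> nest (w :: ws) c n = 0.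
Proof.
by rewrite -subn_eq0 => /eqP nc; case: ws => [|v ws] /=; rewrite nc big_geq.
Qed.

Lemma nest1S (R : pzRingType) (r : R) w n :
  geometric r w -> nest [:: w] 0 n.+1 = 1 + r * nest [:: w] 0 n.
Proof.
move=> [w0 wS] /=; rewrite !subn0 big_nat_recl // w0.
by rewrite big_distrr; congr (_ + _); apply: eq_bigr => i _; apply: wS.
Qed.

Lemma nest_rec (R : pzRingType) (r : R) w v ws c n : geometric r w ->
  nest [:: w, v & ws] c n.+1 =
    nest (v :: ws) c n.+1 + r * nest [:: w, v & ws] c n.
Proof.
move=> [w0 wS]; case: (ltnP n c) => [nc | cn].
  by rewrite !nest_eq0 ?mulr0 ?addr0 // ltnW.
rewrite [LHS]/= [in X in _ + r * X]/= subSn // big_nat_recl // w0 mul1r subn0.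
rewrite big_distrr; congr (_ + _); apply: eq_bigr => i _.
by rewrite wS subSS -mulrA.
Qed.

(** Every bound has the form n - i - ... - c, so only n - c matters. *)
Lemma nest_shift (R : pzRingType) (ws : seq (nat -> R)) c n :
  nest ws c.+1 n.+1 = nest ws c n.
Proof.
elim: ws n => [//|w [|v ws] IH] n; first by rewrite /= subSS.
rewrite [LHS]/= [RHS]/= subSS; apply: eq_big_nat => i /andP[_ ilt].
congr (_ * _); rewrite subSn; first exact: IH.
by apply: ltnW; apply: leq_trans ilt _; apply: leq_subr.
Qed.

(** The solution formula of the recursion y_(n+1) = z_n + r y_n. It holds for
    small n too: where truncated subtraction empties the outer sum, the inner
    one is empty as well. *)
Lemma nestS (R : pzRingType) (r : R) w v ws c n : geometric r w ->
  nest [:: w, v & ws] c.+1 n.+1 =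
    nest (v :: ws) c n + r * nest [:: w, v & ws] c.+1 n.
Proof. by move=> gw; rewrite (nest_rec _ _ _ _ gw) nest_shift. Qed.

(** * Coefficients of a composition *)

Lemma fps_mulS (R : comNzRingType) (u v : fps R) k : u 0%N = 0 ->
  fps_mul u v k.+1 = \sum_(0 <= i < k.+1) u i.+1 * v (k - i)%N.
Proof.
by move=> u0; rewrite /fps_mul big_ord_recl u0 mul0r add0r big_mkord.
Qed.

Lemma fps_expSS (R : comNzRingType) (u : fps R) j k : u 0%N = 0 ->
  fps_exp u j.+1 k.+1 = \sum_(0 <= i < k.+1) u i.+1 * fps_exp u j (k - i)%N.
Proof. exact: fps_mulS. Qed.

Lemma fps_exp1 (R : comNzRingType) (u : fps R) k : fps_exp u 1 k = u k.
Proof.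
rewrite /fps_exp /= /fps_mul big_ord_recr /= subnn mulr1 big1 ?add0r // => i _.
by rewrite /fps_one subn_eq0 leqNgt ltn_ord mulr0.
Qed.

Lemma fps_exp_lt (R : comNzRingType) (u : fps R) j k : u 0%N = 0 ->
  (k < j)%N -> fps_exp u j k = 0.
Proof.
move=> u0; elim: j k => [//|j IH] [_|k kj].
  by rewrite /fps_exp /= /fps_mul big_ord1 u0 mul0r.
rewrite fps_expSS // big1 // => i _; rewrite IH ?mulr0 //.
by apply: leq_ltn_trans (leq_subr i k) _.
Qed.

Lemma fps_compS (R : comNzRingType) (u v : fps R) k :
  fps_comp u v k.+1 = \sum_(0 <= j < k.+1) u j.+1 * fps_exp v j.+1 k.+1.
Proof. by rewrite /fps_comp big_ord_recl /= mulr0 add0r big_mkord. Qed.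

(** What multiplies g_j is the coefficient of x^k in f^j. Since f^j starts at
    x^j, only the entries with j <= k <= 5 matter, and each row of this
    table follows from the previous one by f^(j+1) = f f^j. *)
Lemma fps_comp_coefs (R : comNzRingType) (g f : fps R) : f 0%N = 0 ->
  [/\ fps_comp g f 1%N = g 1%N * f 1%N,
      fps_comp g f 2%N = g 1%N * f 2%N + g 2%N * f 1%N ^+ 2,
      fps_comp g f 3%N = g 1%N * f 3%N + g 2%N * (2 * f 1%N * f 2%N)
        + g 3%N * f 1%N ^+ 3,
      fps_comp g f 4%N = g 1%N * f 4%N
        + g 2%N * (2 * f 1%N * f 3%N + f 2%N ^+ 2)
        + g 3%N * (3 * f 1%N ^+ 2 * f 2%N) + g 4%N * f 1%N ^+ 4
    & fps_comp g f 5%N = g 1%N * f 5%N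
        + g 2%N * (2 * f 1%N * f 4%N + 2 * f 2%N * f 3%N)
        + g 3%N * (3 * f 1%N ^+ 2 * f 3%N + 3 * f 1%N * f 2%N ^+ 2)
        + g 4%N * (4 * f 1%N ^+ 3 * f 2%N) + g 5%N * f 1%N ^+ 5].
Proof.
move=> f0.
have lt := fps_exp_lt f0.
have E22 : fps_exp f 2 2 = f 1%N ^+ 2.
  by rewrite fps_expSS // !big_nat_recl // big_geq //
    !subSS !subn0 !fps_exp1 f0; ring.
have E23 : fps_exp f 2 3 = 2 * f 1%N * f 2%N.
  by rewrite fps_expSS // !big_nat_recl // big_geq //
    !subSS !subn0 !fps_exp1 f0; ring.
have E24 : fps_exp f 2 4 = 2 * f 1%N * f 3%N + f 2%N ^+ 2.
  by rewrite fps_expSS // !big_nat_recl // big_geq //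
    !subSS !subn0 !fps_exp1 f0; ring.
have E25 : fps_exp f 2 5 = 2 * f 1%N * f 4%N + 2 * f 2%N * f 3%N.
  by rewrite fps_expSS // !big_nat_recl // big_geq //
    !subSS !subn0 !fps_exp1 f0; ring.
have E33 : fps_exp f 3 3 = f 1%N ^+ 3.
  by rewrite fps_expSS // !big_nat_recl // big_geq //
    !subSS !subn0 E22 !lt //; ring.
have E34 : fps_exp f 3 4 = 3 * f 1%N ^+ 2 * f 2%N.
  by rewrite fps_expSS // !big_nat_recl // big_geq //
    !subSS !subn0 E22 E23 !lt //; ring.
have E35 : fps_exp f 3 5 = 3 * f 1%N ^+ 2 * f 3%N + 3 * f 1%N * f 2%N ^+ 2.
  by rewrite fps_expSS // !big_nat_recl // big_geq //
    !subSS !subn0 E22 E23 E24 !lt //; ring.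
have E44 : fps_exp f 4 4 = f 1%N ^+ 4.
  by rewrite fps_expSS // !big_nat_recl // big_geq //
    !subSS !subn0 E33 !lt //; ring.
have E45 : fps_exp f 4 5 = 4 * f 1%N ^+ 3 * f 2%N.
  by rewrite fps_expSS // !big_nat_recl // big_geq //
    !subSS !subn0 E33 E34 !lt //; ring.
have E55 : fps_exp f 5 5 = f 1%N ^+ 5.
  by rewrite fps_expSS // !big_nat_recl // big_geq //
    !subSS !subn0 E44 !lt //; ring.
split; rewrite fps_compS !big_nat_recl // big_geq // fps_exp1
  ?E22 ?E23 ?E24 ?E25 ?E33 ?E34 ?E35 ?E44 ?E45 ?E55; ring.
Qed.

(** * Coefficients of an iterate *)

(** At n = 1 the power a1^(n-2) is an inverse, but what it multiplies is an
    empty sum. In the induction step every power of a1 whose exponent depends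
    on n is a1^(n-2) times a power of a1 with a fixed exponent, so that a ring
    identity remains. *)
Lemma fps_iter_coefs (K : fieldType) (f : fps K) (n : nat) :
  f 0%N = 0 -> f 1%N != 0 -> (1 <= n)%N ->
  let a1 := f 1%N in
  let a2 := f 2%N in
  let a3 := f 3%N in
  let a4 := f 4%N in
  let a5 := f 5%N in
  let w1 i := a1 ^+ i in
  let w2 i := a1 ^+ (2 * i) in
  let w3 i := a1 ^+ (3 * i) in
  let w4 i := a1 ^+ (4 * i) in
  [/\ fps_iter f n 1%N = a1 ^+ n,
      fps_iter f n 2%N = a1 ^+ (n - 1) * a2 * nest [:: w1] 0 n,
      fps_iter f n 3%N =
        a1 ^+ (n - 1) * a3 * nest [:: w2] 0 n
        + 2 * a1 ^+ (n - 1) * a2 ^+ 2 * nest [:: w2; w1] 1 n,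
      fps_iter f n 4%N =
        a1 ^+ (n - 1) * a4 * nest [:: w3] 0 n
        + a1 ^+ (n - 1) * a2 * a3 *
          (3 * a1 * nest [:: w3; w2] 1 n + 2 * nest [:: w3; w1] 1 n)
        + a2 ^+ 3 * a1 ^ (n%:Z - 2) *
          (nest [:: w3; w1] 1 n + 6 * a1 ^+ 2 * nest [:: w3; w2; w1] 2 n)
    & fps_iter f n 5%N =
        a1 ^+ (n - 1) * a5 * nest [:: w4] 0 n
        + a1 ^+ (n - 1) * a2 * a4 *
          (2 * nest [:: w4; w1] 1 n + 4 * a1 ^+ 2 * nest [:: w4; w3] 1 n)
        + a1 ^ (n%:Z - 2) * a3 *
          (3 * a1 ^+ 2 * a3 * nest [:: w4; w2] 1 n
           + a2 ^+ 2 *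
             (2 * nest [:: w4; w1] 1 n
              + 4 * a1 ^+ 3 *
                (3 * a1 * nest [:: w4; w3; w2] 2 n
                 + 2 * nest [:: w4; w3; w1] 2 n)
              + 6 * a1 ^+ 2 * nest [:: w4; w2; w1] 2 n
              + 3 * a1 * nest [:: w4; w2] 1 n))
        + a1 ^ (n%:Z - 2) * a2 ^+ 4 *
          ((4 * a1 ^+ 2 * nest [:: w4; w3; w1] 2 n
            + 6 * a1 * nest [:: w4; w2; w1] 2 n)
           + 24 * a1 ^+ 4 * nest [:: w4; w3; w2; w1] 3 n)].
Proof.
case: n => // m f0 a1_neq0 _ a1 a2 a3 a4 a5 w1 w2 w3 w4.
have g1 : geometric a1 w1 := geometric_exp a1.
have g2 : geometric (a1 ^+ 2) w2 := geometric_expM a1 2.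
have g3 : geometric (a1 ^+ 3) w3 := geometric_expM a1 3.
have g4 : geometric (a1 ^+ 4) w4 := geometric_expM a1 4.
elim: m => [|m [IH1 IH2 IH3 IH4 IH5]].
  split; rewrite ?(nest1S _ g1) ?(nest1S _ g2) ?(nest1S _ g3) ?(nest1S _ g4);
    rewrite ?nest_eq0 //= ?subnn ?expr0 /a1 /a2 /a3 /a4 /a5; ring.
have [c1 c2 c3 c4 c5] := fps_comp_coefs (fps_iter f m.+1) f0.
have -> : fps_iter f m.+2 = fps_comp (fps_iter f m.+1) f by [].
have Pz : a1 ^ (m.+2%:Z - 2) = a1 * a1 ^ (m.+1%:Z - 2).
  by rewrite -[X in X * _]expr1z -expfzDr //; congr (_ ^ _); lia.
have Pn : a1 ^+ (m.+1 - 1) = a1 * a1 ^ (m.+1%:Z - 2).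
  rewrite exprnP -[X in X * _]expr1z -expfzDr //; congr (_ ^ _); lia.
have Pn1 : a1 ^+ (m.+2 - 1) = a1 * a1 ^+ (m.+1 - 1).
  by rewrite -exprS; congr (_ ^+ _); lia.
have Pn3 : a1 ^+ m.+2 = a1 * a1 ^+ m.+1 := exprS _ _.
have Pn2 : a1 ^+ m.+1 = a1 * a1 ^+ (m.+1 - 1).
  by rewrite -exprS; congr (_ ^+ _); lia.
rewrite (nest1S _ g1) (nest1S _ g2) (nest1S _ g3) (nest1S _ g4).
rewrite !(nestS _ _ _ m.+1 g4) !(nestS _ _ _ m.+1 g3) !(nestS _ _ _ m.+1 g2).
split; rewrite ?c1 ?c2 ?c3 ?c4 ?c5 ?IH1 ?IH2 ?IH3 ?IH4 ?IH5
  ?Pn3 ?Pn1 ?Pz ?Pn2 ?Pn -/a1 -/a2 -/a3 -/a4 -/a5.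
- ring.
- ring.
- ring.
- ring.
- ring.
Qed.

(** Distributes the outer sums of f_5^(n) over the two-term brackets, which
    leaves only nested sums in the sense of [nest]. *)
Lemma sum_mul_lincomb (R : comPzRingType) (w F G : nat -> R) x y m :
  \sum_(0 <= i < m) w i * (x * F i + y * G i) =
    x * (\sum_(0 <= i < m) w i * F i) + y * (\sum_(0 <= i < m) w i * G i).
Proof.
rewrite !big_distrr -big_split; apply: eq_bigr => i _.
by rewrite mulrDr !(mulrCA (w i)).
Qed.

(* An inclusive sum over 0 <= i <= m - c is written 0 <= i < m - (c - 1), with
   truncated subtraction, so that it is empty exactly when m - c < 0. The
   power a1^(n-2) has an integer exponent: it is a1^(-1) when n = 1. *)
Theorem theorem5p0p1 (K : fieldType) (f : fps K)
    (hf0 : f 0%N = 0) (hf1 : f 1%N != 0) (n : nat) (hn : (1 <= n)%N) :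
  let a1 := f 1%N in
  let a2 := f 2%N in
  let a3 := f 3%N in
  let a4 := f 4%N in
  let a5 := f 5%N in
  [/\ fps_iter f n 1%N = a1 ^+ n,
      fps_iter f n 2%N =
        a1 ^+ (n - 1) * a2 * \sum_(0 <= i < n) a1 ^+ i,
      fps_iter f n 3%N =
        a1 ^+ (n - 1) * a3 * (\sum_(0 <= i < n) a1 ^+ (2 * i))
        + 2%:R * a1 ^+ (n - 1) * a2 ^+ 2 *
          (\sum_(0 <= i < n - 1) a1 ^+ (2 * i) *
             \sum_(0 <= i1 < n - i - 1) a1 ^+ i1),
      fps_iter f n 4%N =
        a1 ^+ (n - 1) * a4 * (\sum_(0 <= i < n) a1 ^+ (3 * i))
        + a1 ^+ (n - 1) * a2 * a3 *
          (3%:R * a1 *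
             (\sum_(0 <= i < n - 1) a1 ^+ (3 * i) *
                \sum_(0 <= i1 < n - i - 1) a1 ^+ (2 * i1))
           + 2%:R *
             (\sum_(0 <= i < n - 1) a1 ^+ (3 * i) *
                \sum_(0 <= i1 < n - i - 1) a1 ^+ i1))
        + a2 ^+ 3 * a1 ^ (n%:Z - 2%:Z) *
          ((\sum_(0 <= i < n - 1) a1 ^+ (3 * i) *
              \sum_(0 <= i1 < n - i - 1) a1 ^+ i1)
           + 6%:R * a1 ^+ 2 *
             (\sum_(0 <= i < n - 2) a1 ^+ (3 * i) *
                \sum_(0 <= i1 < n - i - 2) a1 ^+ (2 * i1) *
                  \sum_(0 <= i2 < n - i - i1 - 2) a1 ^+ i2))
    & fps_iter f n 5%N =
        a1 ^+ (n - 1) * a5 * (\sum_(0 <= i < n) a1 ^+ (4 * i))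
        + a1 ^+ (n - 1) * a2 * a4 *
          (2%:R *
             (\sum_(0 <= i < n - 1) a1 ^+ (4 * i) *
                \sum_(0 <= i1 < n - i - 1) a1 ^+ i1)
           + 4%:R * a1 ^+ 2 *
             (\sum_(0 <= i < n - 1) a1 ^+ (4 * i) *
                \sum_(0 <= i1 < n - i - 1) a1 ^+ (3 * i1)))
        + a1 ^ (n%:Z - 2%:Z) * a3 *
          (3%:R * a1 ^+ 2 * a3 *
             (\sum_(0 <= i < n - 1) a1 ^+ (4 * i) *
                \sum_(0 <= i1 < n - i - 1) a1 ^+ (2 * i1))
           + a2 ^+ 2 *
             (2%:R *
                (\sum_(0 <= i < n - 1) a1 ^+ (4 * i) *
                   \sum_(0 <= i1 < n - i - 1) a1 ^+ i1)
              + 4%:R * a1 ^+ 3 *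
                (\sum_(0 <= i < n - 2) a1 ^+ (4 * i) *
                   (3%:R * a1 *
                      (\sum_(0 <= i1 < n - i - 2) a1 ^+ (3 * i1) *
                         \sum_(0 <= i2 < n - i - i1 - 2) a1 ^+ (2 * i2))
                    + 2%:R *
                      (\sum_(0 <= i1 < n - i - 2) a1 ^+ (3 * i1) *
                         \sum_(0 <= i2 < n - i - i1 - 2) a1 ^+ i2)))
              + 6%:R * a1 ^+ 2 *
                (\sum_(0 <= i < n - 2) a1 ^+ (4 * i) *
                   \sum_(0 <= i1 < n - i - 2) a1 ^+ (2 * i1) *
                     \sum_(0 <= i2 < n - i - i1 - 2) a1 ^+ i2)
              + 3%:R * a1 *
                (\sum_(0 <= i < n - 1) a1 ^+ (4 * i) *
                   \sum_(0 <= i1 < n - i - 1) a1 ^+ (2 * i1))))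
        + a1 ^ (n%:Z - 2%:Z) * a2 ^+ 4 *
          ((\sum_(0 <= i < n - 2) a1 ^+ (4 * i) *
              (4%:R * a1 ^+ 2 *
                 (\sum_(0 <= i1 < n - i - 2) a1 ^+ (3 * i1) *
                    \sum_(0 <= i2 < n - i - i1 - 2) a1 ^+ i2)
               + 6%:R * a1 *
                 (\sum_(0 <= i1 < n - i - 2) a1 ^+ (2 * i1) *
                    \sum_(0 <= i2 < n - i - i1 - 2) a1 ^+ i2)))
           + 24%:R * a1 ^+ 4 *
             (\sum_(0 <= i < n - 3) a1 ^+ (4 * i) *
                \sum_(0 <= i1 < n - i - 3) a1 ^+ (3 * i1) *
                  \sum_(0 <= i2 < n - i - i1 - 3) a1 ^+ (2 * i2) *
                    \sum_(0 <= i3 < n - i - i1 - i2 - 3) a1 ^+ i3))].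
Proof.
move=> a1 a2 a3 a4 a5; rewrite !sum_mul_lincomb.
(* For n = m.+1 the bound n - 0 of [nest] with offset 0 computes to n. *)
case: n hn => // m _.
exact: fps_iter_coefs hf0 hf1 (ltn0Sn m).
Qed.
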